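(* Let $S$ be an inverse semigroup with zero and let $E$ be its semilattice of idempotents. The following are equivalent: (i) $S\ltimes\partial\widehat E$ is topologically free. (ii) $S^c\ltimes\partial\widehat E$ is topologically free. (iii) For all $s\in S^c$ and $e,f_1,\dots,f_n\in E$ with $f_i\le e\le s^{-1}s$ for all $1\le i\le n$ such that there exists $0\ne f\le e$ with $ff_i=0$ for all $1\le i\le n$, there exists $0\ne f'\le e$ with $f'f_i=0$ for all $1\le i\le n$ and $sf'=f'$.
   Context: $\widehat E$ is the space of non-zero multiplicative maps $\chi:E\to\{0,1\}$ with $\chi(0)=0$, with the topology of pointwise convergence. $\widehat E_{\max}\subseteq\widehat E$ is the set of $\chi$ with $\chi^{-1}(1)$ maximal (with respect to inclusion) among all $\chi^{-1}(1)$, $\chi\in\widehat E$, and $\partial\widehat E:=\overline{\widehat E_{\max}}$ (the space of tight filters). $s\in S$ acts via the partial homeomorphism $\{\chi:\chi(s^{-1}s)=1\}\to\{\chi:\chi(ss^{-1})=1\}$, $(s.\chi)(e)=\chi(s^{-1}es)$; this restricts to $\partial\widehat E$. $S\ltimes\partial\widehat E$ is the set of classes $[s,\chi]$ of pairs $(s,\chi)\in S\times\partial\widehat E$ with $\chi(s^{-1}s)=1$, where $[s,\chi]=[t,\psi]$ iff $\chi=\psi$ and $se=te$ for some $e\in E$ with $\chi(e)=1$; source $\chi$, range $s.\chi$, $[s,t.\chi][t,\chi]=[st,\chi]$, $[s,\chi]^{-1}=[s^{-1},s.\chi]$; the topology is the one for which the sets $\{[s,\chi]:\chi\in\partial\widehat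 E,\ \chi(s^{-1}s)=1\}$ are open and the source map restricts to homeomorphisms from them onto $\{\chi\in\partial\widehat E:\chi(s^{-1}s)=1\}$. The unit space is identified with $\partial\widehat E$. $S^c:=\{s\in S: e(ses^{-1})\ne0\text{ for all }e\in E\text{ with }0\ne e\le s^{-1}s\}$, and $S^c\ltimes\partial\widehat E:=\{[s,\chi]\in S\ltimes\partial\widehat E:s\in S^c\}$, an open subgroupoid. An étale groupoid $\mathcal G$ (not necessarily Hausdorff) is topologically free if for every open bisection $\gamma\subseteq\mathcal G\setminus\mathcal G^{(0)}$, the set $\{x\in\mathcal G^{(0)}:\mathcal G_x^x\cap\gamma\ne\emptyset\}$ has empty interior. *)

(* Defs.v *)
From HB Require Import structures.
From mathcomp Require Import all_boot all_order all_classical topology.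

Set Implicit Arguments.
Unset Strict Implicit.
Unset Printing Implicit Defensive.

Local Open Scope classical_set_scope.
Local Open Scope group_scope.

HB.mixin Record Semigroup_isInverse0 S of Semigroup S := {
  sinv : S -> S;
  szero : S;
  mulsVs : forall s : S, s * sinv s * s = s;
  mulVsV : forall s : S, sinv s * s * sinv s = sinv s;
  sinv_uniq : forall s t : S, s * t * s = s -> t * s * t = t -> t = sinv s;
  mul0s : forall s : S, szero * s = szero;
  muls0 : forall s : S, s * szero = szero
}.

#[short(type="invSemigroup0Type")]
HB.structure Definition InvSemigroup0 :=
  {S of Semigroup_isInverse0 S & Semigroup S}.

Arguments szero {s}.

Notation "s ^-1" := (sinv s) : group_scope.

Definition idem (S : invSemigroup0Type) := {e : S | e * e == e}.

Section InverseSemigroup.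
Variable S : invSemigroup0Type.
Implicit Types (s t : S) (e f : idem S).

Lemma sinvK s : s^-1^-1 = s.
Proof. by apply/esym/sinv_uniq; rewrite (mulVsV, mulsVs). Qed.

Lemma sinv_idem s : s * s = s -> s^-1 = s.
Proof. by move=> ss; apply/esym/sinv_uniq; rewrite !ss. Qed.

Lemma idem_mul_subproof s t : s * s = s -> t * t = t -> (s * t) * (s * t) = s * t.
Proof.
move=> ss tt.
have h : t * (s * t)^-1 * s = (s * t)^-1.
  apply: sinv_uniq.
    rewrite -!mulgA [t * (t * _)]mulgA tt [s * (s * _)]mulgA ss.
    by have := mulsVs (s * t); rewrite !mulgA.
  rewrite -!mulgA [s * (s * _)]mulgA ss [t * (t * _)]mulgA tt.
  by have := mulVsV (s * t); rewrite -!mulgA => /(congr1 (fun z => z * s)); 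
     rewrite -!mulgA => ->.
have h2 : (s * t)^-1 * (s * t)^-1 = (s * t)^-1.
  rewrite -{1 2}h -!mulgA.
  have := mulVsV (s * t); rewrite -!mulgA => /(congr1 (fun z => z * s)).
  by rewrite -!mulgA => ->; rewrite mulgA h.
by have E := sinv_idem h2; rewrite sinvK in E; move: h2; rewrite -E.
Qed.

Lemma idem_comm_subproof s t : s * s = s -> t * t = t -> s * t = t * s.
Proof.
move=> ss tt; have st := idem_mul_subproof ss tt; have ts := idem_mul_subproof tt ss.
rewrite -[LHS](sinv_idem st); apply/esym/sinv_uniq.
  by rewrite -!mulgA [t * (t * _)]mulgA tt [s * (s * _)]mulgA ss;
     move: st; rewrite -!mulgA.
by rewrite -!mulgA [s * (s * _)]mulgA ss [t * (t * _)]mulgA tt;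
   move: ts; rewrite -!mulgA.
Qed.

Lemma idemP e : val e * val e = val e. Proof. exact/eqP/(valP e). Qed.

Lemma idemC e f : val e * val f = val f * val e.
Proof. by apply: idem_comm_subproof; exact: idemP. Qed.

Lemma emul_subproof e f : (val e * val f) * (val e * val f) == val e * val f.
Proof. by apply/eqP/idem_mul_subproof; exact: idemP. Qed.
Definition emul e f : idem S := exist (fun x => x * x == x) _ (emul_subproof e f).

Definition eleq e f : Prop := emul e f = e.

Lemma ezero_subproof : szero * szero == szero :> S.
Proof. by rewrite mul0s. Qed.
Definition ezero : idem S := exist (fun x => x * x == x) _ ezero_subproof.

Lemma edom_subproof s : (s^-1 * s) * (s^-1 * s) == s^-1 * s.
Proof. by rewrite mulgA mulVsV. Qed.
Definition edom s : idem S := exist (fun x => x * x == x) _ (edom_subproof s).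

Lemma edom_absorb s e : s * val e = s * val e * s^-1 * s.
Proof.
by rewrite -!mulgA -[s^-1 * s]/(val (edom s)) idemC /= !mulgA mulsVs.
Qed.

Lemma econj_subproof s e : (s * val e * s^-1) * (s * val e * s^-1) == s * val e * s^-1.
Proof.
by apply/eqP; rewrite !mulgA -edom_absorb -(mulgA s) idemP.
Qed.
Definition econj s e : idem S := exist (fun x => x * x == x) _ (econj_subproof s e).

Lemma emulC e f : emul e f = emul f e.
Proof. exact/val_inj/idemC. Qed.
Lemma emulA e f (k : idem S) : emul e (emul f k) = emul (emul e f) k.
Proof. by apply/val_inj; rewrite /= mulgA. Qed.
Lemma emulee e : emul e e = e. Proof. exact/val_inj/idemP. Qed.

Lemma sinvM s t : (s * t)^-1 = t^-1 * s^-1.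
Proof.
have c := idemC (edom s) (edom t^-1); rewrite /= sinvK in c.
apply/esym/sinv_uniq.
  rewrite -!mulgA [t * (t^-1 * _)]mulgA [s^-1 * (s * _)]mulgA.
  by rewrite [(t * _) * _]mulgA -c !mulgA mulsVs -!mulgA (mulgA t) mulsVs.
rewrite -!mulgA [s^-1 * (s * _)]mulgA [t * (t^-1 * _)]mulgA.
by rewrite [(s^-1 * s) * _]mulgA c !mulgA mulVsV -!mulgA (mulgA s^-1) mulVsV.
Qed.

Lemma sinvE e : (val e)^-1 = val e. Proof. exact/sinv_idem/idemP. Qed.

Lemma econj_mul s e f : econj s (emul e f) = emul (econj s e) (econj s f).
Proof. by apply/val_inj => /=; rewrite !mulgA -edom_absorb. Qed.

Lemma econjM s t e : econj (s * t) e = econj s (econj t e).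
Proof. by apply/val_inj; rewrite /= sinvM !mulgA. Qed.

Lemma econjVK s e : econj s^-1 (econj s e) = emul e (edom s).
Proof.
apply/val_inj; rewrite /= sinvK !mulgA -[RHS]mulgA.
have -> : s^-1 * s * val e = val e * (s^-1 * s) := idemC (edom s) e.
by rewrite -!mulgA (mulgA s^-1) -[s^-1 * s]/(val (edom s)) idemP.
Qed.

Lemma econjVKV s e : econj s (econj s^-1 e) = emul e (edom s^-1).
Proof. by rewrite -{1}[s in econj s _]sinvK econjVK. Qed.

Lemma econj0 s : econj s ezero = ezero.
Proof. by apply/val_inj; rewrite /= muls0 mul0s. Qed.

Lemma edomM s t : edom (s * t) = econj t^-1 (edom s).
Proof. by apply/val_inj; rewrite /= sinvM sinvK !mulgA. Qed.

Lemma edomV s : edom s^-1 = econj s (edom s).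
Proof. by apply/val_inj; rewrite /= sinvK !mulgA mulsVs. Qed.

Lemma edom_val e : edom (val e) = e.
Proof. by apply/val_inj; rewrite /= sinvE idemP. Qed.

Lemma econj_val e f : econj (val e) f = emul e f.
Proof. by apply/val_inj; rewrite /= sinvE -mulgA -(idemC e) mulgA idemP. Qed.

End InverseSemigroup.
Arguments ezero {S}.

Section OpenEmbedding.
Variables X Y : topologicalType.

(** For [U] open: [f] restricts to a homeomorphism from [U] onto an open
    subset of [Y]. *)
Definition open_embedding_on (U : set X) (f : X -> Y) : Prop :=
  [/\ set_inj U f, {within U, continuous f} &
      forall V, V `<=` U -> open V -> open (f @` V)].

End OpenEmbedding.

(** [comp g h] is only meaningful if [src g = rng h]; its value on other pairs
    is irrelevant. *)
Record etale_groupoid := EtaleGroupoid {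
  arr : topologicalType;
  obj : topologicalType;
  src : arr -> obj;
  rng : arr -> obj;
  idm : obj -> arr;
  comp : arr -> arr -> arr;
  ginv : arr -> arr;
  src_idm : forall x, src (idm x) = x;
  rng_idm : forall x, rng (idm x) = x;
  src_comp : forall g h, src g = rng h -> src (comp g h) = src h;
  rng_comp : forall g h, src g = rng h -> rng (comp g h) = rng g;
  compA : forall g h k, src g = rng h -> src h = rng k ->
    comp g (comp h k) = comp (comp g h) k;
  comp_idr : forall g, comp g (idm (src g)) = g;
  comp_idl : forall g, comp (idm (rng g)) g = g;
  src_inv : forall g, src (ginv g) = rng g;
  rng_inv : forall g, rng (ginv g) = src g;
  comp_invl : forall g, comp (ginv g) g = idm (src g);
  comp_invr : forall g, comp g (ginv g) = idm (rng g);
  src_continuous : continuous src;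
  rng_continuous : continuous rng;
  idm_continuous : continuous idm;
  comp_continuous :
    {within [set gh | src gh.1 = rng gh.2], continuous (fun gh => comp gh.1 gh.2)};
  ginv_continuous : continuous ginv;
  src_etale : forall g, exists U, [/\ open U, U g & open_embedding_on U src]
}.

Arguments src {e}.
Arguments rng {e}.
Arguments idm {e}.
Arguments comp {e}.
Arguments ginv {e}.

Definition unit_space (G : etale_groupoid) : set (arr G) := range idm.
Arguments unit_space : clear implicits.

Definition open_bisection (G : etale_groupoid) (B : set (arr G)) : Prop :=
  [/\ open B, open_embedding_on B src & open_embedding_on B rng].

Definition isotropy (G : etale_groupoid) (x : obj G) : set (arr G) :=
  [set g | src g = x /\ rng g = x].

Definition topologically_free (G : etale_groupoid) : Prop :=
  forall B : set (arr G), open_bisection B -> B `<=` ~` unit_space G ->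
    [set x | isotropy x `&` B !=set0]° = set0.

Section OpenSubgroupoid.
Variables (G : etale_groupoid) (H : set (arr G)).

Record is_open_subgroupoid : Prop := IsOpenSubgroupoid {
  osg_open : open H;
  osg_idm : forall x, H (idm x);
  osg_comp : forall g h, H g -> H h -> src g = rng h -> H (comp g h);
  osg_inv : forall g, H g -> H (ginv g)
}.

Hypothesis HH : is_open_subgroupoid.

Definition osg_arr : topologicalType := set_type H.
Definition osg_src (g : osg_arr) : obj G := src (val g).
Definition osg_rng (g : osg_arr) : obj G := rng (val g).
Definition osg_id (x : obj G) : osg_arr := exist (fun g => g \in H) _ (mem_set (osg_idm HH x)).
Definition osg_mul (g h : osg_arr) : osg_arr := insubd g (comp (val g) (val h)).
Lemma osg_valP (g : osg_arr) : H (val g). Proof. exact: set_mem (valP g). Qed.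
Definition osg_ginv (g : osg_arr) : osg_arr :=
  exist (fun g => g \in H) _ (mem_set (osg_inv HH (osg_valP g))).

Lemma osg_mulE g h : osg_src g = osg_rng h -> 
  val (osg_mul g h) = comp (val g) (val h).
Proof.
move=> e; rewrite insubdK //; apply: mem_set.
by apply: (osg_comp HH) e; exact: osg_valP.
Qed.

Lemma val_cont : continuous (val : osg_arr -> arr G).
Proof. exact: (@initial_continuous osg_arr (arr G) set_val). Qed.

Lemma osg_cvg T (F : set_system T) (f : T -> osg_arr) (g : osg_arr) :
  Filter F -> (val \o f) @ F --> val g -> f @ F --> g.
Proof.
move=> FF cf U [_ [[V oV <-] /= Vg] VU].
have := cf V (open_nbhs_nbhs (conj oV Vg)).
by rewrite /nbhs /= /nbhs /=; apply: filterS => t Vt; exact: VU.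
Qed.

Lemma osg_emb (U : set (arr G)) (Y : topologicalType) (f : arr G -> Y) :
  open_embedding_on U f -> open_embedding_on (val @^-1` U : set osg_arr) (f \o val).
Proof.
case=> inj cont op; split.
- move=> g h /set_mem Ug /set_mem Uh e; apply: val_inj.
  by apply: inj e; exact: mem_set.
- apply/subspace_continuousP => g Ug A /= nA.
  have nW : nbhs (val g) [set x | U x -> A (f x)] :=
    (subspace_continuousP _ _).1 cont _ Ug A nA.
  by have := @val_cont g _ nW.
- move=> V VU [W oW WV].
  have -> : (f \o val) @` V = f @` (W `&` H).
    rewrite -WV; apply/seteqP; split => y.
      by case=> g Wg <-; exists (val g) => //; split => //; exact: osg_valP.
    by case=> g [Wg Hg] <-; exists (exist (fun g => g \in H) _ (mem_set Hg)).
  apply: op; last by apply: openI => //; exact: (osg_open HH).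
  move=> g [Wg Hg]; apply: (VU (exist (fun g => g \in H) _ (mem_set Hg))).
  by rewrite -WV.
Qed.

Lemma osg_comp_continuous :
  {within [set gh | osg_src gh.1 = osg_rng gh.2],
   continuous (fun gh => osg_mul gh.1 gh.2)}.
Proof.
apply/subspace_continuousP => -[g h] /= e; apply: osg_cvg => A /= nA.
have := (subspace_continuousP _ _).1 (@comp_continuous G) (val g, val h) e.
rewrite /= => /(_ A); rewrite osg_mulE // in nA; move=> /(_ nA).
case=> -[P Q] /= [nP nQ] PQ.
exists (val @^-1` P, val @^-1` Q) => /=.
  by split; exact: val_cont.
move=> [g' h'] /= [Pg Qh] e'; rewrite osg_mulE //.
exact: (PQ (val g', val h')).
Qed.

Definition open_subgroupoid : etale_groupoid.
Proof.
refine (@EtaleGroupoid osg_arr (obj G) osg_src osg_rng osg_id osg_mul osg_ginv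
  _ _ _ _ _ _ _ _ _ _ _ _ _ _ osg_comp_continuous _ _).
- by move=> x; exact: src_idm.
- by move=> x; exact: rng_idm.
- by move=> g h e; rewrite /osg_src osg_mulE //; exact: src_comp.
- by move=> g h e; rewrite /osg_rng osg_mulE //; exact: rng_comp.
- move=> g h k e1 e2; apply: val_inj; rewrite !osg_mulE //.
  + exact: compA.
  + by rewrite /osg_src osg_mulE // src_comp.
  + by rewrite /osg_rng osg_mulE // rng_comp.
- move=> g; apply: val_inj; rewrite osg_mulE; first exact: comp_idr.
  by rewrite /osg_rng /= rng_idm.
- move=> g; apply: val_inj; rewrite osg_mulE; first exact: comp_idl.
  by rewrite /osg_src /= src_idm.
- by move=> g; exact: src_inv.
- by move=> g; exact: rng_inv.
- move=> g; apply: val_inj; rewrite osg_mulE; first exact: comp_invl.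
  exact: src_inv.
- move=> g; apply: val_inj; rewrite osg_mulE; first exact: comp_invr.
  by rewrite /osg_rng /= rng_inv.
- move=> g; apply: continuous_comp; [exact: val_cont|exact: src_continuous].
- move=> g; apply: continuous_comp; [exact: val_cont|exact: rng_continuous].
- by move=> x; apply: osg_cvg; exact: idm_continuous.
- move=> g; apply: (@osg_cvg _ (nbhs g)).
  apply: (@continuous_comp _ _ _ (val : osg_arr -> _) ginv); first exact: val_cont.
  exact: ginv_continuous.
- move=> g; have [U [oU Ug eU]] := src_etale (val g).
  exists (val @^-1` U); split => //; first by exists U.
  exact: osg_emb.
Defined.

End OpenSubgroupoid.

Definition is_character (S : invSemigroup0Type) (chi : idem S -> bool) : Prop :=
  [/\ forall e f, chi (emul e f) = chi e && chi f,
      chi ezero = false &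
      exists e, chi e].

Section Characters.
Variable S : invSemigroup0Type.
Implicit Types (s t : S) (e f : idem S).

(** [set_type] carries the subspace topology, so the closure of [Ehat_max] in
    [bdEhat] is taken inside [Ehat], not inside [{ptws idem S -> bool}]. *)
Definition Ehat : topologicalType :=
  set_type [set chi : {ptws idem S -> bool} | is_character chi].

Definition ev (x : Ehat) (e : idem S) : bool := (val x : idem S -> bool) e.

Definition Ehat_max : set Ehat :=
  [set x | forall y : Ehat, ev x `<=` ev y -> ev y `<=` ev x].

Definition bdEhat : topologicalType := set_type (closure Ehat_max).

Definition bev (x : bdEhat) (e : idem S) : bool := ev (val x) e.

Lemma evP (x : Ehat) : is_character (ev x). Proof. exact: set_mem (valP x). Qed.

Lemma evM (x : Ehat) e f : ev x (emul e f) = ev x e && ev x f.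
Proof. by case: (evP x). Qed.
Lemma bevM (x : bdEhat) e f : bev x (emul e f) = bev x e && bev x f.
Proof. exact: evM. Qed.

Lemma Ehat_eq (x y : Ehat) : (forall e, ev x e = ev y e) -> x = y.
Proof. by move=> h; apply/val_inj/funext. Qed.
Lemma bdEhat_eq (x y : bdEhat) : (forall e, bev x e = bev y e) -> x = y.
Proof. by move=> h; apply/val_inj/Ehat_eq. Qed.

Lemma Ehat_cvg (U : Type) (F : set_system U) (f : U -> Ehat) (x : Ehat) : Filter F ->
  (forall e, F [set u | ev (f u) e = ev x e]) -> f @ F --> x.
Proof.
move=> FF h.
have c : (val \o f) @ F --> (val x : {ptws idem S -> bool}).
  apply/(@pointwise_cvgP (discrete_topology (idem S)) bool) => e A nA; rewrite /= /nbhs /=.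
  apply: filterS (h e) => u ue; have := nbhs_singleton nA.
  by rewrite -[val x e]/(ev x e) -ue.
move=> A [_ [[V oV <-] /= Vg] VU].
have := c V (open_nbhs_nbhs (conj oV Vg)).
by rewrite /nbhs /= /nbhs /=; apply: filterS => u Vu; exact: VU.
Qed.

Lemma ev_nbhs (x : Ehat) e : nbhs x [set y | ev y e = ev x e].
Proof.
have c : (val : Ehat -> {ptws idem S -> bool}) @ nbhs x --> (val x : {ptws idem S -> bool}).
  exact: (@initial_continuous Ehat _ set_val).
have Z := (@pointwise_cvgP (discrete_topology (idem S)) bool _ _ _).1 c e _
  (discrete_set1 (ev x e)).
exact: (Z _).
Qed.


Lemma bev_nbhs (x : bdEhat) e : nbhs x [set y | bev y e = bev x e].
Proof.
have c : (val : bdEhat -> Ehat) @ nbhs x --> val x.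
  exact: (@initial_continuous bdEhat _ set_val).
exact: (c _ (ev_nbhs (val x) e)).
Qed.

Lemma bdEhat_cvg (U : Type) (F : set_system U) (f : U -> bdEhat) (x : bdEhat) :
  Filter F -> (forall e, F [set u | bev (f u) e = bev x e]) -> f @ F --> x.
Proof.
move=> FF h.
have c : (val \o f) @ F --> val x by apply: Ehat_cvg => e; exact: h.
move=> A [_ [[V oV <-] /= Vg] VU].
have := c V (open_nbhs_nbhs (conj oV Vg)).
by rewrite /nbhs /= /nbhs /=; apply: filterS => u Vu; exact: VU.
Qed.

Lemma Eact_subproof s (x : Ehat) : ev x (edom s) ->
  is_character (fun e => ev x (econj s^-1 e)).
Proof.
move=> xs; split.
- by move=> e f; rewrite econj_mul evM.
- by rewrite econj0; case: (evP x).
- by exists (edom s^-1); rewrite edomV econjVK emulee.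
Qed.

Definition Eact s (x : Ehat) (xs : ev x (edom s)) : Ehat :=
  exist (fun chi => chi \in _) _ (mem_set (Eact_subproof xs)).

Lemma EactE s x (xs : ev x (edom s)) e : ev (Eact xs) e = ev x (econj s^-1 e).
Proof. by []. Qed.

Lemma Eact_max s x (xs : ev x (edom s)) : Ehat_max x -> Ehat_max (Eact xs).
Proof.
move=> mx y xy e ye.
have ys : ev y (edom s^-1).
  by apply: (xy (edom s^-1)); rewrite EactE edomV econjVK emulee.
have ye' : ev (Eact ys) (econj s^-1 e).
  by rewrite EactE sinvK econjVKV evM ye ys.
apply: (mx (Eact ys)) ye' => f xf; rewrite EactE sinvK; apply: xy.
by rewrite EactE econjVK evM xf xs.
Qed.

Lemma act_subproof s (x : bdEhat) (xs : bev x (edom s)) :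
  closure Ehat_max (Eact (xs : ev (val x) (edom s))).
Proof.
move=> A nA.
pose a (y : Ehat) := if insub y is Some u then Eact (valP (u : {y : Ehat | ev y (edom s)})) else y.
have aE y (ys : ev y (edom s)) : a y = Eact ys.
  by rewrite /a insubT; apply: Ehat_eq.
have c : a @ nbhs (val x) --> Eact (xs : ev (val x) (edom s)).
  apply: Ehat_cvg => e; have n1 := ev_nbhs (val x) (edom s).
  have n2 := ev_nbhs (val x) (econj s^-1 e).
  apply: filterS2 n1 n2 => y /= y1 y2.
  have ys : ev y (edom s) by rewrite y1.
  by rewrite aE !EactE.
have n : nbhs (val x) (a @^-1` A) := c _ nA.
have xc : closure Ehat_max (val x) by exact: set_mem (valP x).
have [y [my [ay ys]]] := xc _ (filterI n (ev_nbhs (val x) (edom s))).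
have {}ys : ev y (edom s) by move: ys => /= ->; exact: xs.
exists (a y); split => //; rewrite aE; exact: Eact_max.
Qed.

Definition act s (x : bdEhat) (xs : bev x (edom s)) : bdEhat :=
  exist (fun y => y \in _) _ (mem_set (@act_subproof s x xs)).

Lemma actE s x (xs : bev x (edom s)) e : bev (act xs) e = bev x (econj s^-1 e).
Proof. by []. Qed.

Lemma act_nbhs s x (xs : bev x (edom s)) (A : set bdEhat) :
  nbhs (act xs) A -> \forall y \near x, exists ys : bev y (edom s), A (act ys).
Proof.
move=> nA.
pose a (y : bdEhat) := if insub y is Some u then act (valP (u : {y : bdEhat | bev y (edom s)})) else y.
have aE y (ys : bev y (edom s)) : a y = act ys.
  by rewrite /a insubT; apply: bdEhat_eq.
have c : a @ nbhs x --> act xs.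
  apply: bdEhat_cvg => e; have n1 := bev_nbhs x (edom s).
  have n2 := bev_nbhs x (econj s^-1 e).
  apply: filterS2 n1 n2 => y /= y1 y2.
  have ys : bev y (edom s) by rewrite y1.
  by rewrite aE !actE.
have n : nbhs x (a @^-1` A) := c _ nA.
apply: filterS2 n (bev_nbhs x (edom s)) => y /= Ay y1.
have ys : bev y (edom s) by rewrite y1.
by exists ys; rewrite -aE.
Qed.

End Characters.

Section Germs.
Variable S : invSemigroup0Type.
Implicit Types (s t : S) (e f : idem S) (x y : bdEhat S).
Local Open Scope quotient_scope.

Definition pregerm := {p : S * bdEhat S | bev p.2 (edom p.1)}.

Definition germ_rel (p q : pregerm) : bool :=
  `[< (val p).2 = (val q).2 /\
      exists e, bev (val p).2 e /\ (val p).1 * val e = (val q).1 * val e >].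

Lemma germ_rel_equiv : equiv_class_of germ_rel.
Proof.
split.
- move=> p; apply/asboolP; split => //; exists (edom (val p).1); split => //.
  exact: valP p.
- have sy p q : germ_rel p q -> germ_rel q p.
    by move=> /asboolP [pq [e [pe se]]]; apply/asboolP; split => //; exists e; rewrite -pq.
  by move=> p q; apply/idP/idP; exact: sy.
- move=> q p r /asboolP [pq [e [pe se]]] /asboolP [qr [f [qf sf]]].
  apply/asboolP; split; first by rewrite pq.
  exists (emul e f); rewrite bevM pe pq qf; split => //=.
  by rewrite mulgA se -!mulgA idemC !mulgA sf.
Qed.

Canonical germ_equiv := EquivRelPack germ_rel_equiv.

Definition germ_type := {eq_quot germ_equiv}.
HB.instance Definition _ := Choice.on germ_type.
HB.instance Definition _ := EqQuotient.on germ_type.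

Definition germ s x (xs : bev x (edom s)) : germ_type :=
  \pi_germ_type (exist (fun p : S * bdEhat S => bev p.2 (edom p.1)) (s, x) xs).

Lemma germP s x (xs : bev x (edom s)) t y (yt : bev y (edom t)) :
  germ xs = germ yt <-> x = y /\ exists e, bev x e /\ s * val e = t * val e.
Proof.
split; first by move/eqmodP/asboolP.
by move=> h; apply/eqmodP/asboolP.
Qed.

Lemma germ_ind (P : germ_type -> Prop) :
  (forall s x (xs : bev x (edom s)), P (germ xs)) -> forall g, P g.
Proof.
by move=> h g; rewrite -[g]reprK; case: (repr g) => -[s x] xs; exact: h.
Qed.

(** A set [W] of germs is open iff [{x | [s, x] \in W}] is open for every [s].
    By [slice_open], [slice_embedding] and [germ_topology_uniq] below this is
    the unique topology for which the sets [slice s] are open and the source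
    map restricts to homeomorphisms from them onto [{x | x (s^-1 s) = 1}]. *)
Definition germ_open (W : set germ_type) : Prop :=
  forall s, open [set x | exists xs : bev x (edom s), W (germ xs)].

Lemma open_bev e : open [set x | bev x e].
Proof.
rewrite openE => x xe; apply: filterS (bev_nbhs x e) => y /= ->; exact: xe.
Qed.

Lemma germ_openT : germ_open setT.
Proof.
move=> s; rewrite (_ : [set x | _] = [set x | bev x (edom s)]); first exact: open_bev.
apply/seteqP; split => x /=; first by case.
by move=> xs; exists xs.
Qed.

Lemma germ_openI A B : germ_open A -> germ_open B -> germ_open (A `&` B).
Proof.
move=> oA oB s; rewrite (_ : [set x | _] =
  [set x | exists xs : bev x (edom s), A (germ xs)] `&`
  [set x | exists xs : bev x (edom s), B (germ xs)]); first exact: openI.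
apply/seteqP; split => x /=; first by case=> xs [Ax Bx]; split; exists xs.
by case=> -[xs Ax] [xs']; rewrite (bool_irrelevance xs' xs) => Bx; exists xs.
Qed.

Lemma germ_open_bigU (I : Type) (f : I -> set germ_type) :
  (forall i, germ_open (f i)) -> germ_open (\bigcup_i f i).
Proof.
move=> of_ s; rewrite (_ : [set x | _] =
  \bigcup_i [set x | exists xs : bev x (edom s), f i (germ xs)]).
  by apply: bigcup_open => i _; exact: of_.
apply/seteqP; split => x /=; first by case=> xs [i _ fi]; exists i => //; exists xs.
by case=> i _ [xs fi]; exists xs, i.
Qed.

HB.instance Definition _ := @isOpenTopological.Build germ_type germ_open
  germ_openT germ_openI germ_open_bigU.

Lemma germ_openP (W : set germ_type) : open W <-> germ_open W.
Proof. by []. Qed.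

Definition slice s : set germ_type :=
  [set g | exists x (xs : bev x (edom s)), g = germ xs].

Definition germ_src (g : germ_type) : bdEhat S := (val (repr g)).2.
Definition germ_rng (g : germ_type) : bdEhat S := act (valP (repr g)).

Lemma germ_srcE s x (xs : bev x (edom s)) : germ_src (germ xs) = x.
Proof. 
rewrite /germ_src; have : germ xs = \pi_germ_type (repr (germ xs)) by rewrite reprK.
by case: (repr _) => -[t y] yt /germP [].
Qed.

Lemma act_irr s t x y (xs : bev x (edom s)) (yt : bev y (edom t)) :
  germ xs = germ yt -> act xs = act yt.
Proof.
case/germP => xy; case: y / xy yt => yt [e [xe se]].
have key r (xr : bev x (edom r)) f : bev (act xr) f = bev x (econj (r * val e)^-1 f).
  rewrite actE sinvM sinvE econjM econj_val bevM xe andTb //.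
apply: bdEhat_eq => f; by rewrite !key se.
Qed.

Lemma germ_rngE s x (xs : bev x (edom s)) : germ_rng (germ xs) = act xs.
Proof.
rewrite /germ_rng; have : germ xs = \pi_germ_type (repr (germ xs)) by rewrite reprK.
case: (repr _) => -[t y] yt h; rewrite (@act_irr s t x y xs yt h).
exact: bdEhat_eq.
Qed.

Lemma germ_src_continuous : continuous germ_src.
Proof.
apply/continuousP => W oW; apply/germ_openP => s.
rewrite (_ : [set x | _] = [set x | bev x (edom s)] `&` W).
  by apply: openI => //; exact: open_bev.
apply/seteqP; split => x /=; first by case=> xs; rewrite germ_srcE.
by case=> xs Wx; exists xs; rewrite germ_srcE.
Qed.

Lemma slice_open s : open (slice s).
Proof.
apply/germ_openP => t; rewrite openE => x [xt [y [ys /germP [xy [e [xe te]]]]]].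
case: y / xy ys => xs.
have n1 := open_nbhs_nbhs (conj (open_bev e) xe).
have n2 := open_nbhs_nbhs (conj (open_bev (edom s)) xs).
have n3 := open_nbhs_nbhs (conj (open_bev (edom t)) xt).
apply: filterS3 n1 n2 n3 => y ye ys yt; exists yt, y, ys; apply/germP; split => //.
by exists e.
Qed.

Lemma slice_embedding s : open_embedding_on (slice s) germ_src.
Proof.
split.
- move=> _ _ /set_mem [x [xs ->]] /set_mem [y [ys ->]].
  rewrite !germ_srcE => xy; case: y / xy ys => ys.
  by rewrite (bool_irrelevance ys xs).
- by apply: continuous_subspaceT; exact: germ_src_continuous.
- move=> V Vs oV; have := (germ_openP V).1 oV s; congr open; apply/seteqP; split => x /=.
    by case=> xs Vx; exists (germ xs) => //; rewrite germ_srcE.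
  case=> g Vg <-; have [y [ys gE]] := Vs _ Vg; move: Vg; rewrite gE germ_srcE.
  by exists ys.
Qed.

Lemma slice_src s : germ_src @` slice s = [set x | bev x (edom s)].
Proof.
apply/seteqP; split => x /=; first by case=> _ [y [ys ->]] <-; rewrite germ_srcE.
by move=> xs; exists (germ xs); [exists x, xs|rewrite germ_srcE].
Qed.

Lemma germ_topology_uniq (op : set (set germ_type)) :
  (forall A B, op A -> op B -> op (A `&` B)) ->
  (forall (I : Type) (f : I -> set germ_type), (forall i, op (f i)) -> op (\bigcup_i f i)) ->
  (forall s, op (slice s)) ->
  (forall s U, U `<=` slice s -> (op U <-> open (germ_src @` U))) ->
  forall W, op W <-> open W.
Proof.
move=> opI opU ops opE W.
have E s : germ_src @` (W `&` slice s) = [set x | exists xs : bev x (edom s), W (germ xs)].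
  apply/seteqP; split => x /=.
    by case=> g [Wg [y [ys gE]]] <-; rewrite gE germ_srcE; exists ys; rewrite -gE.
  case=> xs Wx; exists (germ xs); last by rewrite germ_srcE.
  by split => //; exists x, xs.
split=> [oW|/germ_openP oW].
  apply/germ_openP => s; rewrite -E; apply/(opE s); first by move=> g [].
  exact: opI.
have -> : W = \bigcup_s (W `&` slice s).
  apply/seteqP; split => g; last by case=> s _ [].
  elim/germ_ind: g => s x xs Wx; exists s => //; split => //; by exists x, xs.
apply: opU => s; apply/(opE s); first by move=> g [].
by rewrite E.
Qed.

(** Characterized by [germ_compE]: [[s, t.x][t, x] = [st, x]].  The value on
    non-composable pairs is junk. *)
Definition germ_comp (g h : germ_type) : germ_type :=
  \pi_germ_type (insubd (repr g) ((val (repr g)).1 * (val (repr h)).1, (val (repr h)).2)).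

Lemma comp_subproof s t x (xt : bev x (edom t)) :
  bev (act xt) (edom s) -> bev x (edom (s * t)).
Proof. by rewrite edomM. Qed.

Lemma germ_compE s y (ys : bev y (edom s)) t x (xt : bev x (edom t))
    (yE : y = act xt) (xst : bev x (edom (s * t))) :
  germ_comp (germ ys) (germ xt) = germ xst.
Proof.
rewrite /germ_comp.
have : germ ys = \pi_germ_type (repr (germ ys)) by rewrite reprK.
have : germ xt = \pi_germ_type (repr (germ xt)) by rewrite reprK.
case: (repr (germ xt)) => -[t' x'] xt' ht.
case: (repr (germ ys)) => -[s' y'] ys' hs /=.
have at_ := @act_irr t t' x x' xt xt' ht.
case: ((@germP s y ys s' y' ys').1 hs) => yy [e [ye se]].
case: ((@germP t x xt t' x' xt').1 ht) => xx [f [xf tf]].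
have xst' : bev x' (edom (s' * t')).
  by apply: (@comp_subproof s' t' x' xt'); rewrite -at_ -yE yy.
have -> : insubd (exist (fun p : S * bdEhat S => bev p.2 (edom p.1)) (s', y') ys')
    (s' * t', x') = exist (fun p : S * bdEhat S => bev p.2 (edom p.1)) (s' * t', x') xst'.
  by apply: val_inj; rewrite insubdK.
apply/esym/germP; split => //; exists (emul (econj t^-1 e) f).
rewrite bevM xf -(actE xt) -yE ye; split => //=.
have tk : t * (val (econj t^-1 e) * val f) = val e * (t * val f).
  have -> : t * (val (econj t^-1 e) * val f) = val e * t * val f.
    rewrite /= sinvK !mulgA.
    have -> : t * t^-1 * val e = val e * (t * t^-1).
      by have := idemC (edom t^-1) e; rewrite /= sinvK.
    by rewrite -(mulgA (val e)) mulsVs.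
  by rewrite mulgA.
have tk' : t * (val (econj t^-1 e) * val f) = t' * (val (econj t^-1 e) * val f).
  by rewrite idemC !mulgA tf.
rewrite -[LHS]mulgA -[in RHS]mulgA -[in RHS]tk'.
by rewrite -[t^-1 * _ * _ * _]/(val (econj t^-1 e) * val f) tk !mulgA se.
Qed.

Lemma inv_subproof s x (xs : bev x (edom s)) : bev (act xs) (edom s^-1).
Proof. by rewrite actE edomV econjVK emulee. Qed.

(** Characterized by [germ_invE]: [[s, x]^-1 = [s^-1, s.x]]. *)
Definition germ_inv (g : germ_type) : germ_type := germ (inv_subproof (valP (repr g))).

Lemma germ_invE s x (xs : bev x (edom s)) (ys : bev (act xs) (edom s^-1)) :
  germ_inv (germ xs) = germ ys.
Proof.
rewrite /germ_inv.
have : germ xs = \pi_germ_type (repr (germ xs)) by rewrite reprK.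
case: (repr (germ xs)) => -[t z] zt h.
have at_ := @act_irr s t x z xs zt h.
case: ((@germP s x xs t z zt).1 h) => xx [e [xe se]].
apply/germP; split => /=; first by rewrite at_; exact: bdEhat_eq.
exists (econj s e); split.
  rewrite [X in bev X](_ : _ = act xs); last by rewrite at_; exact: bdEhat_eq.
  by rewrite actE econjVK bevM xe xs.
have key (r : S) : r^-1 * (r * val e * r^-1) = (r * val e)^-1.
  rewrite sinvM sinvE !mulgA -[r^-1 * r]/(val (edom r)) idemC -mulgA /=.
  by rewrite mulVsV.
have ek : s * val e * s^-1 = t * val e * t^-1.
  have h1 (r : S) : r * val e * r^-1 = (r * val e) * (r * val e)^-1.
    by rewrite sinvM sinvE !mulgA -(mulgA r (val e) (val e)) idemP.
  by rewrite (h1 s) (h1 t) se.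
by rewrite /= key {1}ek key se.
Qed.

(** [germ_id x = [e, x]] for any idempotent [e] with [x e = 1]; see [germ_idE]. *)
Definition germ_id x : germ_type :=
  let: exist e xe := cid (let: And3 _ _ ex := evP (val x) in ex) in
  germ (etrans (congr1 (bev x) (edom_val e)) xe).

Lemma germ_idE x e (xe : bev x (edom (val e))) : germ_id x = germ xe.
Proof.
rewrite /germ_id; case: cid => f xf; apply/germP; split => //.
rewrite edom_val in xe; exists (emul e f); rewrite bevM xe [bev _ _]xf; split => //=.
by rewrite [LHS]mulgA (idemC f) -mulgA idemP mulgA idemP.
Qed.

Lemma germ_src_comp g h : germ_src g = germ_rng h -> germ_src (germ_comp g h) = germ_src h.
Proof.
elim/germ_ind: g => s y ys; elim/germ_ind: h => t x xt; rewrite !germ_srcE germ_rngE => yE.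
have xst : bev x (edom (s * t)) by apply: (@comp_subproof _ _ _ xt); rewrite -yE.
by rewrite (germ_compE _ yE xst) germ_srcE.
Qed.

Lemma act_comp s t x (xt : bev x (edom t)) (ys : bev (act xt) (edom s))
  (xst : bev x (edom (s * t))) : act xst = act ys.
Proof. by apply: bdEhat_eq => e; rewrite !actE sinvM econjM. Qed.

Lemma germ_rng_comp g h : germ_src g = germ_rng h -> germ_rng (germ_comp g h) = germ_rng g.
Proof.
elim/germ_ind: g => s y ys; elim/germ_ind: h => t x xt; rewrite germ_srcE !germ_rngE => yE.
case: _ / (esym yE) ys => ys.
have xst : bev x (edom (s * t)) by apply: (@comp_subproof _ _ _ xt).
by rewrite (germ_compE _ (erefl _) xst) germ_rngE; exact: act_comp.
Qed.

Lemma germ_compA g h k : germ_src g = germ_rng h -> germ_src h = germ_rng k ->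
  germ_comp g (germ_comp h k) = germ_comp (germ_comp g h) k.
Proof.
elim/germ_ind: g => s z zs; elim/germ_ind: h => t y yt; elim/germ_ind: k => u x xu.
rewrite !germ_srcE !germ_rngE => zE yE.
case: _ / (esym yE) yt zE => yt zE; case: _ / (esym zE) zs => zs.
have xtu : bev x (edom (t * u)) by apply: (@comp_subproof _ _ _ xu).
have yst : bev (act xu) (edom (s * t)) by apply: (@comp_subproof _ _ _ yt).
have xstu : bev x (edom (s * t * u)) by apply: (@comp_subproof _ _ _ xu).
have xstu' : bev x (edom (s * (t * u))) by rewrite mulgA.
rewrite (germ_compE yt (erefl _) xtu) (germ_compE zs (erefl _) yst).
rewrite (germ_compE yst (erefl _) xstu) (germ_compE zs _ xstu').
  by apply/germP; split => //; exists (edom u); split; rewrite ?mulgA.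
by symmetry; exact: act_comp.
Qed.

Lemma edom_bev_val x e : bev x e -> bev x (edom (val e)).
Proof. by rewrite edom_val. Qed.

Lemma germ_id_ex x : exists e (xe : bev x (edom (val e))), germ_id x = germ xe.
Proof.
have [_ _ [e xe]] := evP (val x); exists e, (edom_bev_val xe); exact: germ_idE.
Qed.

Lemma act_id x e (xe : bev x (edom (val e))) : act xe = x.
Proof.
apply: bdEhat_eq => f; rewrite actE sinvE econj_val bevM.
by move: (xe); rewrite edom_val => ->.
Qed.

Lemma germ_src_id x : germ_src (germ_id x) = x.
Proof. by have [e [xe ->]] := germ_id_ex x; rewrite germ_srcE. Qed.

Lemma germ_rng_id x : germ_rng (germ_id x) = x.
Proof. by have [e [xe ->]] := germ_id_ex x; rewrite germ_rngE act_id. Qed.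

Lemma germ_comp_idr g : germ_comp g (germ_id (germ_src g)) = g.
Proof.
elim/germ_ind: g => s x xs; rewrite germ_srcE.
have xe := edom_bev_val xs; rewrite (germ_idE xe) /=.
have xse : bev x (edom (s * val (edom s))) by rewrite /= mulgA mulsVs.
rewrite (germ_compE xs _ xse); last by rewrite act_id.
by apply/germP; split => //; exists (edom s); split => //=;
   rewrite !mulgA !mulsVs.
Qed.

Lemma germ_comp_idl g : germ_comp (germ_id (germ_rng g)) g = g.
Proof.
elim/germ_ind: g => s x xs; rewrite germ_rngE.
have xe := edom_bev_val (inv_subproof xs); rewrite (germ_idE xe).
have xse : bev x (edom (val (edom s^-1) * s)) by rewrite /= sinvK mulsVs.
rewrite (germ_compE xe (erefl _) xse).
by apply/germP; split => //; exists (edom s); split => //=; rewrite sinvK mulsVs.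
Qed.

Lemma germ_src_inv g : germ_src (germ_inv g) = germ_rng g.
Proof.
elim/germ_ind: g => s x xs.
by rewrite (germ_invE (inv_subproof xs)) germ_srcE germ_rngE.
Qed.

Lemma act_inv s x (xs : bev x (edom s)) (ys : bev (act xs) (edom s^-1)) : act ys = x.
Proof. by apply: bdEhat_eq => f; rewrite !actE sinvK econjVK bevM xs andbT. Qed.

Lemma germ_rng_inv g : germ_rng (germ_inv g) = germ_src g.
Proof.
elim/germ_ind: g => s x xs.
by rewrite (germ_invE (inv_subproof xs)) germ_srcE germ_rngE act_inv.
Qed.

Lemma germ_comp_invl g : germ_comp (germ_inv g) g = germ_id (germ_src g).
Proof.
elim/germ_ind: g => s x xs; rewrite germ_srcE (germ_invE (inv_subproof xs)).
have xe := edom_bev_val xs; rewrite (germ_idE xe).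
exact: (germ_compE (inv_subproof xs) (erefl _) xe).
Qed.

Lemma germ_comp_invr g : germ_comp g (germ_inv g) = germ_id (germ_rng g).
Proof.
elim/germ_ind: g => s x xs; rewrite germ_rngE (germ_invE (inv_subproof xs)).
have ye := edom_bev_val (inv_subproof xs).
have ye' : bev (act xs) (edom (s * s^-1)) by move: (ye); rewrite /= sinvK.
rewrite (germ_idE ye) (germ_compE xs _ ye'); last by symmetry; exact: act_inv.
by apply/germP; split => //; exists (edom s^-1); split; [exact: inv_subproof|rewrite /= sinvK].
Qed.

Lemma germ_nbhs s x (xs : bev x (edom s)) (W : set germ_type) :
  nbhs (germ xs : germ_type) W <-> \forall y \near x, exists ys : bev y (edom s), W (germ ys).
Proof.
split.
  rewrite nbhsE => -[V [oV Vx] VW].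
  have n : nbhs x [set y | exists ys : bev y (edom s), V (germ ys)].
    by apply: open_nbhs_nbhs; split; [exact: (germ_openP V).1 oV s|exists xs].
  by apply: filterS n => y [ys Vy]; exists ys; exact: VW.
move=> n; have {n} : nbhs x [set y | exists ys : bev y (edom s), W (germ ys)] by exact: n.
rewrite (nbhsE x) => -[U [oU Ux] UW]; rewrite nbhsE.
exists (slice s `&` germ_src @^-1` U); last first.
  move=> _ [[y [ys ->]]]; rewrite /= germ_srcE => Uy.
  by have [ys'] := UW _ Uy; rewrite (bool_irrelevance ys' ys).
split; last by split; [exists x, xs|rewrite /= germ_srcE].
apply: openI; first exact: slice_open.
by move/continuousP: germ_src_continuous; exact.
Qed.

Lemma germ_rng_continuous : continuous germ_rng.
Proof.
elim/germ_ind => s x xs A; rewrite germ_rngE => nA; apply/germ_nbhs.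
by apply: filterS (act_nbhs nA) => y [ys Ay]; exists ys; rewrite /= germ_rngE.
Qed.

Lemma germ_id_continuous : continuous germ_id.
Proof.
move=> x A; have [e [xe ->]] := germ_id_ex x; move/germ_nbhs.
rewrite /nbhs /= /nbhs /=; apply: filterS => y [ye Ay] /=.
by rewrite (germ_idE ye).
Qed.

Lemma germ_inv_continuous : continuous germ_inv.
Proof.
elim/germ_ind => s x xs A; rewrite (germ_invE (inv_subproof xs)).
move/germ_nbhs/act_nbhs => n; apply/germ_nbhs; apply: filterS n => y [ys [yi Ay]].
by exists ys; rewrite /= (germ_invE yi).
Qed.

Lemma germ_comp_continuous :
  {within [set gh | germ_src gh.1 = germ_rng gh.2],
   continuous (fun gh : germ_type * germ_type => germ_comp gh.1 gh.2)}.
Proof.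
apply/subspace_continuousP => -[g h] /=.
elim/germ_ind: g => s y ys; elim/germ_ind: h => t x xt; rewrite germ_srcE germ_rngE => yE.
have xst : bev x (edom (s * t)) by apply: (@comp_subproof _ _ _ xt); rewrite -yE.
move=> A nA; have {nA} : nbhs (germ_comp (germ ys) (germ xt)) A by exact: nA.
rewrite (germ_compE ys yE xst) => /germ_nbhs nA.
pose Q := slice t `&` germ_src @^-1` [set z | exists zst : bev z (edom (s * t)), A (germ zst)].
exists (slice s, Q) => /=.
  split; first by apply: open_nbhs_nbhs; split; [exact: slice_open|exists y, ys].
  apply: filterI; first by apply: open_nbhs_nbhs; split; [exact: slice_open|exists x, xt].
  by apply: germ_src_continuous; rewrite germ_srcE.
move=> [_ _] [/= [y' [ys' ->]] [[x' [xt' ->]]]] /=; rewrite germ_srcE => -[xst' Ax].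
rewrite germ_srcE germ_rngE => yE'.
suff: A (germ_comp (germ ys') (germ xt')) by [].
by rewrite (germ_compE ys' yE' xst').
Qed.

Lemma germ_etale g : exists U, [/\ open U, U g & open_embedding_on U germ_src].
Proof.
elim/germ_ind: g => s x xs; exists (slice s); split; first exact: slice_open.
  by exists x, xs.
exact: slice_embedding.
Qed.

Definition tight_groupoid : etale_groupoid :=
  EtaleGroupoid germ_src_id germ_rng_id germ_src_comp germ_rng_comp germ_compA
    germ_comp_idr germ_comp_idl germ_src_inv germ_rng_inv germ_comp_invl
    germ_comp_invr germ_src_continuous germ_rng_continuous germ_id_continuous
    germ_comp_continuous germ_inv_continuous germ_etale.

Definition Sc : set S :=
  [set s | forall e, e <> ezero -> eleq e (edom s) -> emul e (econj s e) <> ezero].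

Definition Sc_germs : set (arr tight_groupoid) :=
  [set g | exists s x (xs : bev x (edom s)), Sc s /\ g = germ xs].

Lemma emul0e e : emul ezero e = ezero.
Proof. by apply/val_inj; rewrite /= mul0s. Qed.

Lemma econjV_le s e : eleq (econj s^-1 e) (edom s).
Proof. by apply/val_inj; rewrite /= sinvK -!mulgA (mulgA s) mulsVs. Qed.

Lemma econj_neq0 s e : eleq e (edom s) -> e <> ezero -> econj s e <> ezero.
Proof.
by move=> es e0 h; apply: e0; rewrite -es -econjVK h econj0.
Qed.

Lemma Sc_idem e : Sc (val e).
Proof.
move=> f f0; rewrite edom_val econj_val => fe.
by rewrite (emulC e) [emul f e]fe emulee.
Qed.

Lemma Sc_inv s : Sc s -> Sc s^-1.
Proof.
move=> cs e e0 es.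
have f0 : econj s^-1 e <> ezero by exact: econj_neq0.
have := cs _ f0 (econjV_le s e).
by rewrite econjVKV [emul e _]es emulC.
Qed.

Lemma Sc_mul s t : Sc s -> Sc t -> Sc (s * t).
Proof.
move=> cs ct e e0; rewrite edomM => est.
have et : eleq e (edom t) by rewrite /eleq -[in LHS]est -emulA [emul _ (edom t)]econjV_le est.
set k := econj t e.
have ks : eleq k (edom s).
  have kE : k = emul (emul k (edom t^-1)) (edom s).
    by rewrite /k -[in LHS]est econj_mul econjVKV (emulC (edom s)) emulA.
  by rewrite /eleq {1}kE -emulA emulee -kE.
have f0 : emul e k <> ezero by exact: ct.
have fs : eleq (emul e k) (edom s) by rewrite /eleq -emulA [emul k _]ks.
move: (cs _ f0 fs) => + h; apply; rewrite econjM -/k in h.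
rewrite econj_mul (emulC (econj s e)) emulA -(emulA e k) (emulC k) (emulA e) h.
by rewrite !emul0e.
Qed.

Lemma Sc_germs_subgroupoid : is_open_subgroupoid Sc_germs.
Proof.
split.
- have -> : Sc_germs = \bigcup_(s in Sc) slice s.
    apply/seteqP; split => g; first by case=> s [x [xs [cs ->]]]; exists s => //; exists x, xs.
    by case=> s cs [x [xs ->]]; exists s, x, xs.
  by apply: bigcup_open => s _; exact: slice_open.
- move=> x; have [e [xe xE]] := germ_id_ex x.
  by exists (val e), x, xe; split => //; exact: Sc_idem.
- move=> _ _ [s [y [ys [cs ->]]]] [t [x [xt [ct ->]]]] /=.
  rewrite germ_srcE germ_rngE => yE.
  have xst : bev x (edom (s * t)) by apply: (@comp_subproof _ _ _ xt); rewrite -yE.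
  by exists (s * t), x, xst; split; [exact: Sc_mul|exact: germ_compE].
- move=> _ [s [x [xs [cs ->]]]]; exists s^-1, (act xs), (inv_subproof xs).
  by split; [exact: Sc_inv|exact: germ_invE].
Qed.

Definition Sc_groupoid : etale_groupoid := open_subgroupoid Sc_germs_subgroupoid.

End Germs.

Arguments tight_groupoid : clear implicits.
Arguments Sc_groupoid : clear implicits.

(* Main.v *)
(** The sets [{x | x m = 1}] with [m <> 0] form a pi-base of the space of tight
    characters.  For [s] in [S^c], a character moved by [s] would yield such a
    set on which some idempotent separates [x] from [s.x], hence a nonzero
    [m <= s^-1 s] with [m (s m s^-1) = 0]; so [S^c] acts trivially.  This gives
    (ii) => (iii), because all germs [[s, x]] with [x e = 1] and [x f_i = 0] are
    isotropic.  Conversely, if [[s, y]] is a non-unit isotropic germ of an open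
    bisection for all [y] with [y e = 1], then [s e] lies in [S^c], and (iii)
    with [n = 0] makes one of these germs a unit. *)
From mathcomp Require Import all_boot all_classical topology.
Require Import Defs.

Set Implicit Arguments.
Unset Strict Implicit.
Unset Printing Implicit Defensive.

Local Open Scope classical_set_scope.
Local Open Scope group_scope.

(** * Restriction and congruence of open embeddings *)

Section OpenEmbeddings.
Variables (X Y : topologicalType).
Implicit Types (U V : set X) (f g : X -> Y).

Lemma open_embedding_onS U V f :
  V `<=` U -> open_embedding_on U f -> open_embedding_on V f.
Proof.
move=> VU [inj cont op]; split.
- by move=> x y /set_mem Vx /set_mem Vy; apply: inj; apply/mem_set/VU.
- exact: continuous_subspaceW cont.
- by move=> W WV; apply: op; exact: subset_trans VU.
Qed.

Lemma eq_open_embedding_on U f g :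
  {in U, f =1 g} -> open_embedding_on U f -> open_embedding_on U g.
Proof.
move=> fg [inj cont op]; split.
- by move=> x y Ux Uy; rewrite -!fg //; exact: inj.
- by apply: subspace_eq_continuous cont => x Ux; exact: fg.
- move=> V VU oV; rewrite -(eq_imagel (f := f)); first exact: op.
  by move=> x Vx; apply/fg/mem_set/VU.
Qed.

End OpenEmbeddings.

(** * Topological freeness passes to open subgroupoids *)

Section TopologicallyFreeSubgroupoid.
Variables (G : etale_groupoid) (H : set (arr G)) (HH : is_open_subgroupoid H).
Let K := open_subgroupoid HH.

Lemma osg_open_embedding (B : set (osg_arr H)) (Y : topologicalType)
    (f : arr G -> Y) : continuous f ->
  open_embedding_on B (f \o val) -> open_embedding_on (val @` B) f.
Proof.
move=> cf [inj _ op]; split.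
- move=> _ _ /set_mem[g Bg <-] /set_mem[h Bh <-] e; congr val.
  by apply: inj e; exact: mem_set.
- exact: continuous_subspaceT.
- move=> V VB oV.
  have -> : f @` V = (f \o val) @` (val @^-1` V : set (osg_arr H)).
    apply/seteqP; split=> [y [v Vv <-]|y [v Vv <-]]; last by exists (val v).
    by have [g Bg gv] := VB _ Vv; exists g; rewrite /= gv.
  apply: op; last by exists V.
  by move=> g /= /VB[h Bh /val_inj <-].
Qed.

(** As [H] is open and contains all units, an open bisection of [K] off the units is one of [G],
    meeting the same isotropy groups. *)
Lemma topologically_free_open_subgroupoid :
  topologically_free G -> topologically_free K.
Proof.
move=> tfG B [oB eS eR] BU.
have BG : open_bisection (val @` (B : set (osg_arr H))).
  split.
  - have [W oW WB] := oB.
    have -> : val @` (B : set (osg_arr H)) = W `&` H.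
      rewrite -WB; apply/seteqP; split=> [_ [g Wg <-]|g [Wg Hg]].
        by split=> //; exact: osg_valP.
      by exists (exist (fun g => g \in H) _ (mem_set Hg)).
    by apply: openI => //; exact: osg_open.
  - by apply: osg_open_embedding => //; exact: src_continuous.
  - by apply: osg_open_embedding => //; exact: rng_continuous.
have BGU : val @` (B : set (osg_arr H)) `<=` ~` unit_space G.
  move=> _ [g Bg <-] [x _ xg]; apply: (BU _ Bg); exists x => //.
  exact: val_inj.
rewrite -(tfG _ BG BGU); congr interior.
apply/seteqP; split=> x [g [[gs gr] Bg]].
  by exists (val (g : osg_arr H)); split=> //; exists g.
by move: Bg gs gr => [h Bh <-] hs hr; exists h.
Qed.

End TopologicallyFreeSubgroupoid.

(** * Filters of idempotents and maximal characters *)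

Section TightCharacters.
Variable S : invSemigroup0Type.
Implicit Types (s : S) (e f k l m : idem S) (x y : bdEhat S) (u v w : Ehat S).

Lemma ev0 u : ev u ezero = false.
Proof. by case: (evP u). Qed.

Lemma ev_neq0 u e : ev u e -> e <> ezero.
Proof. by move=> ue e0; move: ue; rewrite e0 ev0. Qed.

Lemma emulACA e f k l : emul (emul e f) (emul k l) = emul (emul e k) (emul f l).
Proof. by rewrite -!emulA; congr emul; rewrite !emulA (emulC f). Qed.

Lemma eleq_emull e f : eleq (emul e f) e.
Proof. by rewrite /eleq emulC emulA emulee. Qed.

Lemma eleq_trans e f k : eleq e f -> eleq f k -> eleq e k.
Proof. by rewrite /eleq => ef fk; rewrite -{1}ef -emulA fk. Qed.

Lemma eleq_emul2 e e' f f' : eleq e e' -> eleq f f' -> eleq (emul e f) (emul e' f').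
Proof. by rewrite /eleq emulACA => -> ->. Qed.

Lemma ev_le u e f : eleq e f -> ev u e -> ev u f.
Proof. by move=> <-; rewrite evM => /andP[]. Qed.

Definition character (chi : idem S -> bool) (h : is_character chi) : Ehat S :=
  exist (fun chi : idem S -> bool => chi \in _) chi (mem_set h).

(** The principal filter of [e], which is proper because [e] is nonzero. *)
Lemma up_character e : e <> ezero -> is_character (fun f => `[< eleq e f >]).
Proof.
move=> e0; split.
- move=> f k; apply/asboolP/andP => [h|[/asboolP ef /asboolP ek]].
    by split; apply/asboolP; apply: eleq_trans h _;
       [|rewrite emulC]; exact: eleq_emull.
  by rewrite /eleq emulA ef ek.
- apply/asboolP => h; apply: e0; rewrite -h emulC; exact: emul0e.
- by exists e; apply/asboolP; exact: emulee.
Qed.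

(** The filter generated by [u] and [e]; the hypothesis says that it is proper. *)
Lemma join_character u e : (forall k, ev u k -> emul k e <> ezero) ->
  is_character (fun f => `[< exists2 k, ev u k & eleq (emul k e) f >]).
Proof.
move=> ue; split.
- move=> f g; apply/asboolP/andP => [[k uk h]|[]].
    by split; apply/asboolP; exists k => //; apply: eleq_trans h _;
       [|rewrite emulC]; exact: eleq_emull.
  move=> /asboolP[k uk kf] /asboolP[l ul lg].
  exists (emul k l); first by rewrite evM uk.
  have -> : emul (emul k l) e = emul (emul k e) (emul l e).
    by rewrite emulACA emulee.
  exact: eleq_emul2.
- apply/asboolP => -[k uk h]; apply: (ue k uk).
  by rewrite -h emulC; exact: emul0e.
- have [_ _ [k uk]] := evP u; exists e; apply/asboolP; exists k => //.
  by rewrite emulC; exact: eleq_emull.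
Qed.

(** Otherwise the filter generated by [u] and [e] would be proper and strictly larger than [u]. *)
Lemma Ehat_max_separated u e : Ehat_max u -> ~~ ev u e ->
  exists2 k, ev u k & emul k e = ezero.
Proof.
move=> mu ue; apply: contrapT => h.
have ne k : ev u k -> emul k e <> ezero by move=> uk ke; apply: h; exists k.
move/negP: ue; apply; apply: (mu (character (join_character ne))).
  by move=> k uk; apply/asboolP; exists k => //; exact: eleq_emull.
have [_ _ [k uk]] := evP u; apply/asboolP; exists k => //.
by rewrite emulC; exact: eleq_emull.
Qed.

(** The union of a nonempty chain of filters, the upper bound for Zorn's lemma. *)
Lemma chain_character (T : Type) (A : set T) (F : T -> Ehat S) :
  total_on A (fun a b => ev (F a) `<=` ev (F b)) -> A !=set0 ->
  is_character (fun f => `[< exists2 a, A a & ev (F a) f >]).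
Proof.
move=> tot [a Aa]; split.
- move=> f g; apply/asboolP/andP => [[b Ab]|[/asboolP[b Ab bf] /asboolP[c Ac cg]]].
    by rewrite evM => /andP[bf bg]; split; apply/asboolP; exists b.
  have [bc|cb] := tot _ _ Ab Ac; [exists c|exists b] => //; rewrite evM.
    by rewrite cg andbT; exact: bc.
  by rewrite bf; exact: cb.
- by apply/asboolP => -[b _]; rewrite ev0.
- by have [_ _ [k ak]] := evP (F a); exists k; apply/asboolP; exists a.
Qed.

Lemma Ehat_max_ex e : e <> ezero -> exists2 u, Ehat_max u & ev u e.
Proof.
move=> e0; pose T := {u : Ehat S | ev u e}.
pose R (a b : T) := `[< ev (val a) `<=` ev (val b) >].
have [] := @Zorn T R.
- by move=> a; apply/asboolP.
- move=> a b c /asboolP ab /asboolP bc; apply/asboolP; exact: subset_trans bc.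
- move=> a b /asboolP ab /asboolP ba; apply/val_inj/Ehat_eq => f.
  by apply/idP/idP => [/ab|/ba].
- move=> A totR; have [A0|nA0] := pselect (A !=set0); last first.
    (* The empty chain is bounded by the principal filter of [e]. *)
    have xe : ev (character (up_character e0)) e.
      by apply/asboolP; exact: emulee.
    by exists (exist (fun u => ev u e) _ xe) => a Aa; case: nA0; exists a.
  have tot : total_on A (fun a b => ev (val a) `<=` ev (val b)).
    by move=> a b Aa Ab; have [/asboolP|/asboolP] := totR a b Aa Ab; [left|right].
  have [a Aa] := A0.
  have xe : ev (character (chain_character tot A0)) e.
    by apply/asboolP; exists a => //; exact: valP a.
  exists (exist (fun u => ev u e) _ xe) => b Ab; apply/asboolP => f bf.
  by apply/asboolP; exists b.
(* Every [v] above [u] again has value 1 at [e], so maximality within [T] is maximality in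
   [Ehat]. *)
- move=> [u ue] mu; exists u => // v uv.
  have ve : ev v e by exact: uv.
  have /mu/(congr1 val) /= -> : R (exist _ u ue) (exist (fun u => ev u e) v ve) by apply/asboolP.
  by [].
Qed.

(** * A pi-base of the space of tight characters *)

Lemma bdEhat_ex e : e <> ezero -> exists x, bev x e.
Proof.
move=> /Ehat_max_ex[u mu ue].
by exists (exist (fun u => u \in _) u (mem_set (subset_closure mu))).
Qed.

Lemma bev_neq0 x e : bev x e -> e <> ezero.
Proof. exact: ev_neq0. Qed.

Lemma bev_le x e f : eleq e f -> bev x e -> bev x f.
Proof. exact: ev_le. Qed.

(* The filter generated by the sets [{v | v e = 1}] with [u e = 1] converges to [u]. *)
Lemma Ehat_max_nbhs u (A : set (Ehat S)) : Ehat_max u -> nbhs u A ->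
  exists2 e, ev u e & forall v, ev v e -> A v.
Proof.
move=> mu; pose F : set_system (Ehat S) :=
  [set P | exists2 e, ev u e & forall v, ev v e -> P v].
have FF : Filter F.
  split.
  - by have [_ _ [e ue]] := evP u; exists e.
  - move=> P Q [e ue eP] [f uf fQ]; exists (emul e f); first by rewrite evM ue.
    by move=> v; rewrite evM => /andP[ve vf]; split; [exact: eP|exact: fQ].
  - by move=> P Q PQ [e ue eP]; exists e => // v /eP; exact: PQ.
suff : (idfun : Ehat S -> Ehat S) @ F --> u by move=> h /h.
apply: Ehat_cvg => e; have [ue|ue] := boolP (ev u e); first by exists e.
(* The condition [v e = 0] is implied by [v k = 1] for a [k] with [k e = 0]. *)
have [k uk ke] := Ehat_max_separated mu ue; exists k => // v vk /=.
by apply/negbTE; have := ev0 v; rewrite -ke evM vk => /= ->.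
Qed.

(** The idempotent [m] comes from a maximal character close to [x]; [x] itself may vanish at [m]. *)
Lemma bdEhat_nbhs x (A : set (bdEhat S)) : nbhs x A ->
  exists2 m, m <> ezero & forall y, bev y m -> A y.
Proof.
move=> [_ [[V oV <-] /= Vx] VA].
have [u [mu Vu]] := (set_mem (valP x) : closure _ _) V (open_nbhs_nbhs (conj oV Vx)).
have [m um mV] := Ehat_max_nbhs mu (open_nbhs_nbhs (conj oV Vu)).
exists m; first exact: ev_neq0 um.
by move=> y ym; apply: VA; exact: mV.
Qed.

Lemma bev_disjoint m e : (forall y, bev y m -> ~~ bev y e) -> emul m e = ezero.
Proof.
move=> h; apply: contrapT => /bdEhat_ex[y]; rewrite bevM => /andP[ym].
exact/negP/h.
Qed.

Lemma bev_refine x (A : set (bdEhat S)) e : nbhs x A -> bev x e ->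
  exists m, [/\ m <> ezero, eleq m e & forall y, bev y m -> A y].
Proof.
move=> nA xe; have n : nbhs x (A `&` [set y | bev y e]).
  by apply: filterI => //; apply: open_nbhs_nbhs; split=> //; exact: open_bev.
have [m m0 mA] := bdEhat_nbhs n; exists (emul m e); split.
- have [y ym] := bdEhat_ex m0; apply: (@bev_neq0 y); rewrite bevM ym /=.
  by have [] := mA _ ym.
- by rewrite emulC; exact: eleq_emull.
- by move=> y; rewrite bevM => /andP[/mA[]].
Qed.

(** * [S^c] and trivial action *)

Lemma act_Sc s x (xs : bev x (edom s)) : Sc s -> act xs = x.
Proof.
move=> cs; apply: bdEhat_eq => e; rewrite actE; set e' := econj s^-1 e.
(* On [A] both values to be compared, at [e] and at [e'], are constant. *)
pose A := [set y | bev y e = bev x e] `&` [set y | bev y e' = bev x e'].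
have nA : nbhs x A by apply: filterI; exact: bev_nbhs.
have [m [m0 ms mA]] := bev_refine nA xs.
(* Both a point [y] with [y m = 1] and its image [z] under [s^-1] lie in [A],
   and [z e' = y e]. *)
have [y] := bdEhat_ex (cs m m0 ms); rewrite bevM => /andP[ym ysm].
have yr : bev y (edom s^-1).
  by apply: bev_le ysm; rewrite -{1}[s]sinvK; exact: econjV_le.
have [/= ye _] := mA y ym.
have zm : bev (act yr) m by rewrite actE sinvK.
have [_ /=] := mA _ zm.
by rewrite actE sinvK econjVKV bevM yr andbT ye => <-.
Qed.

Lemma edom_mul_val s e : eleq e (edom s) -> edom (s * val e) = e.
Proof. by rewrite edomM sinvE econj_val. Qed.

(** A partial converse of [act_Sc]: for nonzero [f <= e], a tight [y] with [y f = 1] is fixed by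
    [s], so [y (s f s^-1) = 1] too and the product is nonzero. *)
Lemma act_fixed_Sc s e : eleq e (edom s) ->
  (forall y (ys : bev y (edom s)), bev y e -> act ys = y) -> Sc (s * val e).
Proof.
move=> es fix_y f f0.
rewrite (edom_mul_val es) econjM econj_val => fe; have [y yf] := bdEhat_ex f0.
have ys : bev y (edom s) by apply: bev_le yf; exact: eleq_trans es.
apply: (@bev_neq0 y); rewrite bevM yf /= [emul e f]emulC fe.
rewrite -(fix_y y ys) ?actE ?econjVK; last exact: bev_le yf.
by rewrite bevM yf ys.
Qed.

(** * Germs of one element over an open set, and unit germs *)

Definition germs_on s (U : set (bdEhat S)) : set (germ_type S) :=
  [set g | exists x (xs : bev x (edom s)), U x /\ g = germ xs].

Lemma germs_on_sub s U : germs_on s U `<=` slice s.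
Proof. by move=> g [x [xs [_ ->]]]; exists x, xs. Qed.

Lemma germs_on_open s U : open U -> open (germs_on s U).
Proof.
move=> oU; have -> : germs_on s U = slice s `&` (@germ_src S) @^-1` U.
  apply/seteqP; split=> [g [x [xs [Ux ->]]]|g [[x [xs ->]]]].
    by split; [exists x, xs|rewrite /= germ_srcE].
  by rewrite /= germ_srcE => Ux; exists x, xs.
apply: openI; first exact: slice_open.
by move/continuousP: (@germ_src_continuous S); exact.
Qed.

(** Lets the open embedding by the source serve for the range as well. *)
Lemma Sc_germs_on_rng s U : Sc s ->
  {in germs_on s U, (@germ_src S) =1 (@germ_rng S)}.
Proof.
by move=> cs g /set_mem[x [xs [_ ->]]]; rewrite germ_srcE germ_rngE act_Sc.
Qed.

(** If [[s, x] = [e, x]], then [s] and [e] agree on some [k], so [s] fixes [e k]. *)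
Lemma germ_unit s x (xs : bev x (edom s)) :
  unit_space (tight_groupoid S) (germ xs) <-> exists2 k, bev x k & s * val k = val k.
Proof.
split.
- case=> y _ /=; have [e [ye ->]] := germ_id_ex y => /germP[yx [k [yk ek]]].
  exists (emul e k); first by rewrite -yx bevM yk andbT -(edom_val e).
  by rewrite /= idemC mulgA -ek -mulgA -idemC mulgA idemP.
- case=> k xk sk; exists x => //; rewrite /= (germ_idE (edom_bev_val xk)).
  by apply/germP; split=> //; exists k; rewrite sk idemP.
Qed.

End TightCharacters.

(** * The equivalence of the three conditions *)

(** The hypothesis is condition (iii) for the empty family. *)
Lemma fixed_idem_topologically_free (S : invSemigroup0Type) :
  (forall (s : S) (e : idem S), Sc s -> eleq e (edom s) -> e <> ezero ->
     exists f, [/\ f <> ezero, eleq f e & s * val f = val f]) ->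
  topologically_free (tight_groupoid S).
Proof.
move=> fixed B [oB [injB _ _] _] BU; apply/seteqP; split=> // x ix.
have [g [[gx _] Bg]] := interior_subset ix.
elim/germ_ind: g gx Bg => s x'; rewrite /= => xs; rewrite germ_srcE => xx Bx.
case: _ / xx ix => {x} ix; have {}Bx : nbhs (germ xs) B by apply: open_nbhs_nbhs.
(* For all [y] with [y m = 1], the germ [[s, y]] lies in [B], and [B] contains an isotropic germ at
   [y]. *)
have [m [m0 ms mA]] := bev_refine (filterI ((germ_nbhs xs B).1 Bx) ix) xs.
have iso y (ys : bev y (edom s)) : bev y m -> act ys = y.
  move=> /mA[[ys' Bys] [h [[hy hr] Bh]]].
  rewrite (bool_irrelevance ys' ys) in Bys.
  (* The source is injective on [B], so the isotropic germ is [[s, y]] itself. *)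
  have hE : h = germ ys.
    by apply: injB; [exact: mem_set|exact: mem_set|rewrite hy [RHS]germ_srcE].
  by rewrite -(germ_rngE ys) -hE [LHS]hr.
have csm : Sc (s * val m) by exact: act_fixed_Sc iso.
have [|//|f [f0 fm sf]] := fixed _ m csm.
  by rewrite (edom_mul_val ms); exact: emulee.
have [y yf] := bdEhat_ex f0.
have [[ys By] _] := mA y (bev_le fm yf).
apply: (BU _ By); apply/germ_unit; exists f => //.
by rewrite -{2}sf -mulgA -[val m * val f]/(val (emul m f)) emulC fm.
Qed.

(** By contradiction: without such an [f'], the germs of [s] over [U] form an open bisection of
    isotropic non-units, and [U] is nonempty because of [f0]. *)
Lemma topologically_free_fixed_idem (S : invSemigroup0Type) (s : S) (e : idem S)
    (n : nat) (f : 'I_n -> idem S) (f0 : idem S) :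
  topologically_free (Sc_groupoid S) -> Sc s -> eleq e (edom s) ->
  f0 <> ezero -> eleq f0 e -> (forall i, emul f0 (f i) = ezero) ->
  exists f', [/\ f' <> ezero, eleq f' e, forall i, emul f' (f i) = ezero &
                 s * val f' = val f'].
Proof.
move=> tf cs es f00 f0e f0f; apply: contrapT => nof.
pose U : set (bdEhat S) := [set x | bev x e] `&` [set x | forall i, ~~ bev x (f i)].
have Us x : U x -> bev x (edom s) by case=> + _; exact: bev_le.
have oU : open U.
  apply: openI; first exact: open_bev.
  rewrite openE => x /= xf.
  apply: (@filter_forall _ _ (fun i => [set y | ~~ bev y (f i)]) (nbhs x)) => i.
  by apply: filterS (bev_nbhs x (f i)) => y /= ->; exact: xf.
(* The pi-base turns a point of [U] into a nonzero idempotent below [e] and orthogonal to all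
   [f i]. *)
have shrink x k : U x -> bev x k -> exists m,
    [/\ m <> ezero, eleq m k, eleq m e & forall i, emul m (f i) = ezero].
  move=> Ux xk; have xek : bev x (emul e k) by rewrite bevM xk andbT; case: Ux.
  have [m [m0 mk mU]] := bev_refine (open_nbhs_nbhs (conj oU Ux)) xek.
  exists m; split=> //.
  - by apply: eleq_trans mk _; rewrite emulC; exact: eleq_emull.
  - by apply: eleq_trans mk _; exact: eleq_emull.
  - by move=> i; apply: bev_disjoint => y /mU[_]; exact.
pose B : set (arr (Sc_groupoid S)) :=
  (val : osg_arr (@Sc_germs S) -> _) @^-1` germs_on s U.
have eB : open_embedding_on (germs_on s U) (@germ_src S).
  apply: open_embedding_onS (slice_embedding s); exact: germs_on_sub.
have bB : open_bisection B.
  split; first by exists (germs_on s U) => //; exact: germs_on_open.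
    exact: (osg_emb (Sc_germs_subgroupoid S) (f := src : arr (tight_groupoid S) -> _)).
  apply: (osg_emb (Sc_germs_subgroupoid S) (f := rng : arr (tight_groupoid S) -> _)).
  apply: eq_open_embedding_on eB; exact: Sc_germs_on_rng.
have BU : B `<=` ~` unit_space (Sc_groupoid S).
  move=> g [x [xs [Ux gE]]] [y _ yg].
  have [k xk sk] : exists2 k, bev x k & s * val k = val k.
    by apply/(germ_unit xs); exists y => //; rewrite -gE -yg.
  (* Being below the fixed idempotent [k], the idempotent [m] is fixed by [s] and serves as the
     excluded [f']. *)
  have [m [m0 mk me mf]] := shrink x k Ux xk; apply: nof; exists m; split=> //.
  by rewrite -mk emulC /= mulgA sk.
have [x xf0] := bdEhat_ex f00.
have Ux : U x.
  split; first exact: bev_le xf0.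
  move=> i; apply/negP => xfi; apply: (@bev_neq0 _ x (emul f0 (f i))) => //.
  by rewrite bevM xf0.
suff : [set x | isotropy (G := Sc_groupoid S) x `&` B !=set0]° x by rewrite tf.
apply: filterS (open_nbhs_nbhs (conj oU Ux)) => y Uy.
have ys := Us y Uy.
have gH : Sc_germs (germ ys) by exists s, y, ys.
exists (exist (fun g => g \in @Sc_germs S) _ (mem_set gH)); split; last first.
  by exists y, ys.
by split; rewrite /= /osg_src /osg_rng /= ?germ_srcE // germ_rngE act_Sc.
Qed.

Theorem theorem5p11 (S : invSemigroup0Type) :
  (topologically_free (tight_groupoid S) <-> topologically_free (Sc_groupoid S))
  /\
  (topologically_free (Sc_groupoid S) <->
    forall (s : S) (e : idem S) (n : nat) (f : 'I_n -> idem S),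
      Sc s -> (forall i, eleq (f i) e) -> eleq e (edom s) ->
      (exists f0 : idem S,
         [/\ f0 <> ezero, eleq f0 e & forall i, emul f0 (f i) = ezero]) ->
      exists f' : idem S,
        [/\ f' <> ezero, eleq f' e, forall i, emul f' (f i) = ezero &
            s * val f' = val f']).
Proof.
have i_ii : topologically_free (tight_groupoid S) ->
    topologically_free (Sc_groupoid S).
  exact: topologically_free_open_subgroupoid.
have iii_i : (forall (s : S) (e : idem S) (n : nat) (f : 'I_n -> idem S),
    Sc s -> (forall i, eleq (f i) e) -> eleq e (edom s) ->
    (exists f0 : idem S,
       [/\ f0 <> ezero, eleq f0 e & forall i, emul f0 (f i) = ezero]) ->
    exists f' : idem S,
      [/\ f' <> ezero, eleq f' e, forall i, emul f' (f i) = ezero &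
          s * val f' = val f']) -> topologically_free (tight_groupoid S).
  move=> iii; apply: fixed_idem_topologically_free => s e cs es e0.
  (* On the empty index type [fun=> ezero] is only a placeholder family, and [e] itself is the
     required [f0]. *)
  have [||f' [f'0 f'e _ sf']] := iii s e 0%N (fun=> ezero) cs _ es.
  - by case.
  - by exists e; split=> [//||[]//]; exact: emulee.
  - by exists f'.
have ii_iii := @topologically_free_fixed_idem S.
split; split; first exact: i_ii.
- by move=> tf; apply: iii_i => s e n f cs _ es [f0 [f00 f0e f0f]];
     exact: ii_iii f0f.
- by move=> tf s e n f cs _ es [f0 [f00 f0e f0f]]; exact: ii_iii f0f.
- by move=> /iii_i/i_ii.
Qed.
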